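(* Let $\Omega$ be a Polish space equipped with its Borel sigma algebra, and let $\mathcal P,\mathcal Q\subseteq\mathcal M_1$ be nonempty sets of probability measures that are both convex and weakly compact. Then $$\mathsf G=\mathsf G_b=\mathsf G_{bb}=\mathsf G_{bc}=\min_{\mathsf Q\in\mathcal Q}\ \min_{\mathsf P\in\mathcal P}H(\mathsf Q\mid\mathsf P).$$
   Context: $\mathcal M_1$ is the set of Borel probability measures on $\Omega$, equipped with the usual weak topology (convergence of integrals of functions in $C_b$, the bounded continuous real functions on $\Omega$); ''weakly compact'' refers to this topology. An e-variable for $\mathcal P$ is a measurable $X:\Omega\to[0,\infty]$ with $\int X\,d\mathsf P\le1$ for all $\mathsf P\in\mathcal P$. $\mathcal E$ is the set of all e-variables; $\mathcal E_b$ is the set of e-variables bounded from above; $\mathcal E_{bb}$ is the set of e-variables that are bounded from above and bounded away from zero; $\mathcal E_{bc}=\mathcal E_{bb}\cap C_b$. Define $\mathsf G,\mathsf G_b,\mathsf G_{bb},\mathsf G_{bc}$ as $\sup_X\inf_{\mathsf Q\in\mathcal Q}\mathbb E_{\mathsf Q}[\log X]$ with $X$ ranging over $\mathcal E,\mathcal E_b,\mathcal E_{bb},\mathcal E_{bc}$ respectively. Conventions: $\log0=-\infty$, $\log\infty=\infty$; $\mathbb E_{\mathsf Q}[\log X]=\mathbb E_{\mathsf Q}[(\log X)^+]-\mathbb E_{\mathsf Q}[(\log X)^-]$ if $\mathbb E_{\mathsf Q}[(\log X)^-]<\infty$, and $=-\infty$ if $\mathbb E_{\mathsf Q}[(\log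 X)^-]=\infty$. $H(\mathsf Q\mid\mathsf P)=\int\log(d\mathsf Q/d\mathsf P)\,d\mathsf Q$ if $\mathsf Q\ll\mathsf P$ and $=\infty$ otherwise. *)

(* Defs.v *)
From mathcomp Require Export all_boot all_order all_algebra.
From mathcomp Require Export all_classical all_reals all_analysis.
From mathcomp Require Export measurable_realfun.

Set Implicit Arguments.
Unset Strict Implicit.
Unset Printing Implicit Defensive.

Import Order.TTheory GRing.Theory Num.Theory.
Import numFieldNormedType.Exports.

Local Open Scope classical_set_scope.
Local Open Scope ring_scope.

Definition separable (T : topologicalType) : Prop :=
  exists2 D : set T, countable D & dense D.

Definition completely_metrizable (R : realType) (T : topologicalType) : Prop :=
  exists (M : metricType R) (f : T -> M) (g : M -> T),
    [/\ forall F : set_system M, ProperFilter F -> cauchy F ->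
          exists x : M, F --> x,
        cancel f g, cancel g f, continuous f & continuous g].

Definition polish (R : realType) (T : topologicalType) : Prop :=
  separable T /\ completely_metrizable R T.

(* [g_sigma_algebraType] needs a pointed type; a space that carries a probability
   measure is nonempty, and the point is never used. *)
Notation borel T := (g_sigma_algebraType (@open T)).

(* A term of type [probability] also assigns values to non-measurable sets.
   Everything below depends only on the values on Borel sets, except membership
   in a set of such terms; see [convex_family]. *)
Notation M1 R T := (probability (borel T) R).

Section Families.
Context (R : realType) (T : ptopologicalType).
Implicit Types (P Q : M1 R T) (PP QQ : set (M1 R T)).

Definition Cb : set (T -> R) := [set f | continuous f /\ bounded_fun f].

Definition Cb_integral (P : M1 R T) : prod_topology (fun _ : {f | Cb f} => R) :=
  fun f => (\int[P]_x (sval f : borel T -> R) x)%R.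

(* The initial topology of [Cb_integral] is the coarsest one that makes
   P |-> \int[P]_x f x continuous for every f in Cb, because [prod_topology] is
   the topology of pointwise convergence. *)
Definition weakly_compact (PP : set (M1 R T)) : Prop :=
  compact (PP : set (initial_topology Cb_integral)).

(* The mixture is only required to be in PP up to its values on non-Borel
   sets. *)
Definition convex_family (PP : set (M1 R T)) : Prop :=
  forall P0 P1 (t : R), PP P0 -> PP P1 -> 0 <= t <= 1 ->
  exists2 P, PP P & forall A : set (borel T), measurable A ->
    P A = ((1 - t)%:E * P0 A + t%:E * P1 A)%E.

End Families.

Local Open Scope ereal_scope.
Local Open Scope charge_scope.

Section Numeraire.
Context (R : realType) (T : ptopologicalType).
Implicit Types (P Q : M1 R T) (PP QQ : set (M1 R T)).
Implicit Types X : borel T -> \bar R.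

Definition evariable PP : set (borel T -> \bar R) :=
  [set X : borel T -> \bar R |
    [/\ measurable_fun setT X, forall x, 0 <= X x &
        forall P, PP P -> \int[P]_x X x <= 1]].

Definition evariable_b PP : set (borel T -> \bar R) :=
  evariable PP `&`
  [set X : borel T -> \bar R | exists M : R, forall x, X x <= M%:E].

Definition evariable_bb PP : set (borel T -> \bar R) :=
  evariable_b PP `&`
  [set X : borel T -> \bar R | exists2 c : R, (0 < c)%R & forall x, c%:E <= X x].

Definition evariable_bc PP : set (borel T -> \bar R) :=
  evariable_bb PP `&`
  [set X : borel T -> \bar R | exists2 f : T -> R, Cb f & forall x, X x = (f x)%:E].

Definition ext_expectation Q (Y : borel T -> \bar R) : \bar R :=
  if \int[Q]_x Y^\- x < +oo
  then \int[Q]_x Y^\+ x - \int[Q]_x Y^\- x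
  else -oo.

Definition growth QQ (E : set (borel T -> \bar R)) : \bar R :=
  ereal_sup
    [set ereal_inf [set ext_expectation Q (fun x => lne (X x)) | Q in QQ]
    | X in E].

Definition rel_entropy Q P : \bar R :=
  if `[< Q `<< P >] then
    ext_expectation Q (fun x => lne (('d (charge_of_finite_measure Q) '/d P) x))
  else +oo.

End Numeraire.

Definition is_minimum (R : realType) (S : set (\bar R)) (m : \bar R) : Prop :=
  S m /\ lbound S m.

(* The library's extended addition has +oo - +oo = -oo, so its integral follows
   the same convention as [ext_expectation]. *)
Lemma ext_expectationE (R : realType) (T : ptopologicalType) (Q : M1 R T)
    (Y : borel T -> \bar R) : ext_expectation Q Y = \int[Q]_x Y x.
Proof.
rewrite /ext_expectation [RHS]integralE; case: ifPn => //.
by rewrite -leNgt leye_eq => /eqP ->; rewrite addeNy.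
Qed.

(* Main.v *)
From HB Require Import structures.
Require Import Defs.
From mathcomp Require Import finmap ring lra.

(** The theorem is a minimax statement built on a variational formula for
    relative entropy. For a bounded continuous [f] put
    [gap f P Q = int f dQ - int exp f dP + 1]. Then [H(Q | P)] is the supremum of
    [gap f P Q] over [f], by the Donsker-Varadhan formula in its linearized form.
    The gap is affine and weakly continuous in [(P, Q)] and concave in [f], and
    [PP * QQ] is convex and weakly compact, so the supremum over [f] and the
    minimum over [(P, Q)] can be exchanged ([minimax_convexlike]).

    On the side of e-variables: if [gap f] is at least [r] on [PP * QQ], then
    [exp f] divided by the supremum of its expectations over [PP] is a continuous
    e-variable, bounded and bounded away from zero, with expected logarithm at
    least [r] under every [Q] ([growth_bc_ge]). Hence some pair [(P, Q)] in
    [PP * QQ] has [H(Q | P)] at most the growth over continuous e-variables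
    ([rel_entropy_le_growth]).

    Conversely, every e-variable [X] satisfies [E_Q[log X] <= H(Q | P)], by
    integrating [log X <= log Z + X / Z - 1] with [Z = dQ/dP]
    ([growth_le_rel_entropy]). The four growths increase with the class of
    e-variables, so they are squeezed between the smallest one and [H(Q | P)] at
    the optimal pair, which is therefore a joint minimizer. The same argument for
    the family reduced to a single [Q] gives the minimum over [PP] for that [Q].

    The inequality [H(Q | P) <= sup_f gap f P Q] is the analytic part. For
    bounded measurable [f] it results from testing the gap on multiples of the
    indicator of a [P]-null set, which forces [Q] to be absolutely continuous
    ([entropy_gap_dominates]), and then on truncations of [log Z]
    ([integral_ln_density_le]). Bounded measurable functions reduce to bounded
    continuous ones because the latter are dense in [L1 (P + Q)] on a metrizable
    space ([entropy_gap_bounded]). *)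

Set Implicit Arguments.
Unset Strict Implicit.
Unset Printing Implicit Defensive.

Import Order.TTheory GRing.Theory Num.Theory.
Import numFieldNormedType.Exports.

Local Open Scope classical_set_scope.
Local Open Scope ring_scope.

(** * A minimax theorem for convexlike families *)

Section Minimax.
Context {R : realType}.

(** The planar case. The points [(f x, g x)] span a set that avoids the quadrant
    where both coordinates are at most [c], and a line through the corner of that
    quadrant separates the two. Each point with [f x <= c] forces the weight [l]
    to be at least [(c - f x) / (g x - f x)]; the supremum of these constraints
    is compatible with the upper constraints coming from the points with
    [g x < c], because otherwise a point of the segment between two offending
    points would lie in the quadrant. No topology is involved, and the price is
    the non-strict conclusion. *)
Lemma convexlike_alternative (K : Type) (A : set K) (f g : K -> R) (c : R) :
  (forall x y t, A x -> A y -> 0 <= t <= 1 -> exists2 z, A z &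
     f z <= (1 - t) * f x + t * f y /\ g z <= (1 - t) * g x + t * g y) ->
  (forall x, A x -> c < f x \/ c < g x) ->
  exists2 l, 0 <= l <= 1 & forall x, A x -> c <= (1 - l) * f x + l * g x.
Proof.
move=> cvxA pos.
pose S := [set l : R | l = 0 \/
  exists x, [/\ A x, f x <= c & l = (c - f x) / (g x - f x)]].
have gt_c x : A x -> f x <= c -> c < g x.
  by move=> Ax fx; have [|//] := pos _ Ax; rewrite ltNge fx.
have S_ge0 : forall l, S l -> 0 <= l <= 1.
  move=> l [->|[x [Ax fx ->]]]; first by rewrite lexx ler01.
  have gx := gt_c _ Ax fx.
  by rewrite divr_ge0 ?ler_pdivrMr /=; lra.
have S0 : S 0 by left.
have supS : has_sup S.
  by split; [exists 0 | exists 1 => l /S_ge0/andP[]].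
have sup_le u : (forall l, S l -> l <= u) -> sup S <= u.
  by move=> Su; apply: ge_sup => //; exists 0.
exists (sup S).
  by rewrite sup_ubound//= ?sup_le//; [move=> l /S_ge0/andP[]|case: supS].
move=> x Ax; have [fx|fx] := leP (f x) c.
  have gx := gt_c _ Ax fx.
  have : (c - f x) / (g x - f x) <= sup S.
    by apply: sup_ubound; [case: supS|right; exists x].
  by rewrite ler_pdivrMr ?subr_gt0; [lra|exact: le_lt_trans gx].
have : 0 <= sup S <= 1.
  by rewrite sup_ubound//= ?sup_le//; [move=> l /S_ge0/andP[]|case: supS].
have [gx|gx] := leP c (g x); first by nra.
move=> /andP[s0 s1].
suff : sup S <= (f x - c) / (f x - g x).
  by rewrite ler_pdivlMr; [lra|lra].
apply: sup_le => _ [->|[y [Ay fy ->]]]; first by rewrite divr_ge0; lra.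
have gy := gt_c _ Ay fy.
rewrite ler_pdivrMr; last lra.
rewrite mulrAC ler_pdivlMr; last lra.
rewrite leNgt; apply/negP => bad.
(* the point of the segment from [y] to [x] at which the interpolation of [f]
   equals [c] lies in the forbidden quadrant *)
pose t := (c - f y) / (f x - f y).
have d0 : 0 < f x - f y by lra.
have tE : t * (f x - f y) = c - f y by rewrite mulfVK// gt_eqF.
have t01 : 0 <= t <= 1.
  by rewrite divr_ge0 ?ler_pdivrMr /=; lra.
have [z Az [fz gz]] := cvxA _ _ _ Ay Ax t01.
have fzc : f z <= c by nra.
have gzc : (1 - t) * g y + t * g x <= c.
  by rewrite -(ler_pM2r d0); nra.
by have [] := pos _ Az; lra.
Qed.

(** Induction on the number of functions: on the sublevel set of the first one,
    which is again convexlike, the others admit a good combination [k], and the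
    planar case combines [k] with the first function. Each step loses strictness,
    so the thresholds [c' < d < e < c] are spread out. *)
Lemma convexlike_finite_alternative (I K : Type) (F : I -> K -> R) (i0 : I) :
  (forall i j t, 0 <= t <= 1 -> exists k, forall x,
     (1 - t) * F i x + t * F j x <= F k x) ->
  forall (s : seq I) (A : set K) (c c' : R), c' < c ->
  (forall x y t, A x -> A y -> 0 <= t <= 1 -> exists2 z, A z &
     forall i, F i z <= (1 - t) * F i x + t * F i y) ->
  (forall x, A x -> has (fun i => c < F i x) s) ->
  exists k, forall x, A x -> c' <= F k x.
Proof.
move=> concF; elim=> [|i s IH] A c c' c'c cvxA pos.
  by exists i0 => x /pos.
pose d := (c + c') / 2; pose e := (c + d) / 2.
have [dc de ec] : [/\ c' < d, d < e & e < c] by rewrite /e /d; split; lra.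
have [k Fk] : exists k, forall x, (A `&` [set x | F i x <= d]) x -> e <= F k x.
  apply: (IH _ c) => // [x y t [Ax fx] [Ay fy] t01|x [Ax /= fx]].
    have [z Az Fz] := cvxA _ _ _ Ax Ay t01; exists z => //; split => //=.
    by apply: le_trans (Fz i) _; move: fx fy t01 => /=; nra.
  by have /= /orP[|//] := pos _ Ax; lra.
have [l l01 Fl] : exists2 l, 0 <= l <= 1 &
    forall x, A x -> d <= (1 - l) * F i x + l * F k x.
  apply: convexlike_alternative => [x y t Ax Ay t01|x Ax].
    by have [z Az Fz] := cvxA _ _ _ Ax Ay t01; exists z.
  have [fx|fx] := leP (F i x) d; last by left.
  by right; apply: lt_le_trans (Fk x _).
have [m Fm] := concF i k l l01.
by exists m => x Ax; apply: le_trans (Fm x); apply: le_trans (Fl x Ax); lra.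
Qed.

Lemma lt_EFin_dense (v : \bar R) (x : R) :
  (v < x%:E)%E -> exists2 r, (v < r%:E)%E & r < x.
Proof.
case: v => [v| |] // => [|_]; last by exists (x - 1); rewrite ?ltNyr//; lra.
by rewrite lte_fin => vx; exists ((v + x) / 2); rewrite ?lte_fin; lra.
Qed.

(** Otherwise the parts of [A] that are missed by finitely many sets [U y] form
    the base of a proper filter on [A]; if [p] is a cluster point of it, the part
    missed by [U p] alone contradicts that [U p] is a neighbourhood of [p]. *)
Lemma compact_finite_subcover (K : topologicalType) (A : set K)
    (U : K -> set K) :
  compact A -> (forall x, A x -> nbhs x (U x)) ->
  exists2 s : seq K, (forall y, y \in s -> A y) &
    forall x, A x -> exists2 y, y \in s & U y x.
Proof.
move=> cA nU; apply: contrapT => nocover.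
pose D := [set s : seq K | forall y, y \in s -> A y].
pose B (s : seq K) := A `&` [set x | forall y, y \in s -> ~ U y x].
have DF : Filter (filter_from D B).
  apply: filter_from_filter; first by exists [::].
  move=> s1 s2 D1 D2; exists (s1 ++ s2).
    by move=> y; rewrite mem_cat => /orP[/D1|/D2].
  by move=> x [Ax Bx]; split; split=> // y ys; apply: Bx; rewrite mem_cat ys ?orbT.
have PF : ProperFilter (filter_from D B).
  apply: filter_from_proper => s Ds; apply: contrapT => B0; apply: nocover.
  exists s => // x Ax; apply: contrapT => Ux; apply: B0; exists x; split => //.
  by move=> y ys Uyx; apply: Ux; exists y.
have [|p [Ap clp]] := cA _ PF; first by exists [::] => // x [].
have [|x [[_ /(_ p)]]] := clp (B [:: p]) (U p) _ (nU p Ap).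
  by exists [:: p] => // y; rewrite inE => /eqP ->.
by rewrite mem_head => /(_ isT).
Qed.

(** Fan's minimax theorem, in contrapositive form: if the supremum over [i]
    exceeds [v] at every point of [A], then one index exceeds [v] uniformly on
    [A]. Compactness reduces this to finitely many indices. Only
    convexity-like inequalities are asked for, because a mixture of two measures
    of a family belongs to it merely up to the values on non-Borel sets. *)
Lemma minimax_convexlike (I : Type) (K : topologicalType) (F : I -> K -> R)
    (A : set K) (v : \bar R) :
  compact A -> A !=set0 ->
  (forall i, continuous (F i)) ->
  (forall i j t, 0 <= t <= 1 -> exists k, forall x,
     (1 - t) * F i x + t * F j x <= F k x) ->
  (forall x y t, A x -> A y -> 0 <= t <= 1 -> exists2 z, A z &
     forall i, F i z <= (1 - t) * F i x + t * F i y) ->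
  (forall x, A x -> exists i, (v < (F i x)%:E)%E) ->
  exists k r, (v < r%:E)%E /\ forall x, A x -> r <= F k x.
Proof.
move=> cA [x0 Ax0] ctF concF cvxA pos.
have /choice[h hP] : forall x, exists ir : I * R, A x ->
    (v < ir.2%:E)%E /\ ir.2 < F ir.1 x.
  move=> x; have [Ax|nAx] := pselect (A x).
    have [i /lt_EFin_dense[r vr rF]] := pos x Ax.
    by exists (i, r).
  by have [i _] := pos _ Ax0; exists (i, 0).
have [|D DA Dcov] :=
    @compact_finite_subcover K A (fun y => [set x | (h y).2 < F (h y).1 x]) cA.
  move=> x Ax; apply: open_nbhs_nbhs; split; last by have [] := hP _ Ax.
  rewrite -[X in open X]/(F (h x).1 @^-1` [set z | (h x).2 < z]).
  by apply: open_comp => [y _|]; [exact: ctF|exact: open_gt].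
have [c vc cD] : exists2 c : R, (v < c%:E)%E &
    forall y, y \in D -> c <= (h y).2.
  elim: D DA {Dcov} => [_|y s IH sA].
    have [i /lt_EFin_dense[r vr _]] := pos _ Ax0.
    by exists r.
  have [|c vc cs] := IH; first by move=> z zs; apply: sA; rewrite inE zs orbT.
  have [vy _] := hP y (sA y (mem_head _ _)).
  exists (Num.min c (h y).2); first by rewrite EFin_min lt_min vc vy.
  move=> z; rewrite inE => /orP[/eqP ->|zs]; first by rewrite ge_min lexx orbT.
  by rewrite ge_min cs.
have [c' vc' c'c] := lt_EFin_dense vc.
have [i0 _] := pos _ Ax0.
have [|k Fk] := @convexlike_finite_alternative I K F i0 concF
  [seq (h y).1 | y <- D] A c c' c'c cvxA _.
- move=> x Ax; have [y yD xy] := Dcov x Ax.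
  rewrite has_map; apply/hasP; exists y => //=.
  by apply: le_lt_trans xy; exact: cD.
- by exists k, c'.
Qed.

End Minimax.

(** * Exponential and logarithm *)

Lemma norm_expR_le (R : realType) (y M : R) : `|y| <= M -> `|expR y| <= expR M.
Proof.
by move=> yM; rewrite ger0_norm ?expR_ge0// ler_expR (le_trans (ler_norm _)).
Qed.

Lemma expR_lipschitz (R : realType) (M a b : R) : `|a| <= M -> `|b| <= M ->
  `|expR a - expR b| <= expR M * `|a - b|.
Proof.
wlog ba : a b / b <= a => [wlog_ba aM bM|].
  have [ba|/ltW ab] := leP b a; first exact: wlog_ba.
  by rewrite distrC (distrC a); exact: wlog_ba.
move=> aM _; rewrite !ger0_norm ?subr_ge0 ?ler_expR//.
have : expR a - expR b <= expR a * (a - b).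
  have -> : expR b = expR a * expR (b - a) by rewrite -expRD addrC subrK.
  rewrite -[X in X - _]mulr1 -mulrBr ler_wpM2l ?expR_ge0//.
  by have := expR_ge1Dx (b - a); lra.
move/le_trans; apply; rewrite ler_wpM2r ?subr_ge0// ler_expR.
exact: le_trans (ler_norm a) aM.
Qed.

Lemma expR_convex (R : realType) (a b t : R) : 0 <= t <= 1 ->
  expR ((1 - t) * a + t * b) <= (1 - t) * expR a + t * expR b.
Proof.
move=> /andP[t0 t1]; set c := _ + t * b.
have tangent (x : R) : expR c * (1 + (x - c)) <= expR x.
  have -> : expR x = expR c * expR (x - c) by rewrite -expRD addrC subrK.
  by rewrite ler_wpM2l ?expR_ge0// expR_ge1Dx.
have ta : (1 - t) * (expR c * (1 + (a - c))) <= (1 - t) * expR a.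
  by rewrite ler_wpM2l ?subr_ge0.
have tb : t * (expR c * (1 + (b - c))) <= t * expR b by rewrite ler_wpM2l.
apply: le_trans (lerD ta tb); rewrite /c le_eqVlt; apply/orP; left; apply/eqP.
by rewrite -/c; set E := expR c; rewrite /c; ring.
Qed.

(** The preimage of the ray above [r] is the ray above [expR r]. *)
Lemma measurable_lne (R : realType) : measurable_fun [set: \bar R] (@lne R).
Proof.
apply: (measurability _ (ErealGenOInfty.measurableE R)).
move=> /= _ [_ [r ->] <-]; rewrite setTI.
suff -> : (@lne R) @^-1` `]r%:E, +oo[ = `](expR r)%:E, +oo[%classic.
  exact: emeasurable_itv.
apply/seteqP; split=> -[x| |] /=; rewrite !in_itv/= ?andbT ?ltNyr ?ltry//.
- case: (leP x 0) => // x0; rewrite !lte_fin => rx.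
  by rewrite -ltr_expR lnK ?posrE in rx.
- rewrite lte_fin => rx; have x0 := lt_trans (expR_gt0 r) rx.
  by rewrite leNgt x0 /= lte_fin -ltr_expR lnK ?posrE.
Qed.

(** The inequality [log x <= l + x * exp (- l) - 1], written with positive and
    negative parts so that every term is nonnegative and can be integrated
    without any integrability assumption. *)
Lemma lne_split_le (R : realType) (x : \bar R) (l : R) : (0 <= x)%E ->
  (maxe (lne x) 0 + maxe (- l%:E) 0 + 1 <=
   maxe l%:E 0 + x * (expR (- l))%:E + maxe (- lne x) 0)%E.
Proof.
case: x => [x||]//; last first.
  move=> _; rewrite gt0_mulye ?lte_fin ?expR_gt0// addey; last by rewrite -EFin_max.
  by rewrite [lne _]/= maxNye adde0 leey.
rewrite lee_fin le_eqVlt => /orP[/eqP <-|x0].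
  rewrite le0_lneNy ?lexx // [(- -oo)%E]/= maxye mul0e adde0 addey ?leey//.
  by rewrite -EFin_max.
rewrite lne_EFin// -!EFinN -!EFin_max -EFinM -!EFinD lee_fin.
have := expR_ge1Dx (ln x - l); rewrite expRD lnK ?posrE//.
by rewrite /Num.max; do 4 case: ltP => ?; lra.
Qed.

(** * Integration of bounded functions *)

Lemma bounded_integrable d (T : measurableType d) (R : realType)
    (mu : {finite_measure set T -> \bar R}) (D : set T) (g : T -> R) (M : R) :
  measurable D -> measurable_fun D g -> (forall x, `|g x| <= M) ->
  mu.-integrable D (EFin \o g).
Proof.
move=> mD mg gM; apply: measurable_bounded_integrable => //.
  by rewrite ltey_eq fin_num_measure.
by exists M; split=> [|N MN x _]; [exact: num_real|exact: le_trans (ltW MN)].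
Qed.

Lemma measurable_dist d (T : measurableType d) (R : realType) (f g : T -> R) :
  measurable_fun [set: T] f -> measurable_fun [set: T] g ->
  measurable_fun [set: T] (fun x => `|f x - g x|%:E).
Proof.
move=> mf mg; apply/measurable_EFinP/measurableT_comp => //.
exact: measurable_funB.
Qed.

Section Integrals.
Context d (T : measurableType d) (R : realType).
Variable mu : {finite_measure set T -> \bar R}.

Lemma integral_full_set (D : set T) (F : T -> \bar R) :
  measurable D -> mu (~` D) = 0%E -> measurable_fun setT F ->
  (\int[mu]_x F x = \int[mu]_(x in D) F x)%E.
Proof.
move=> mD D0 mF; rewrite [RHS]integral_mkcond.
apply: ae_eq_integral => //.
  by apply/(measurable_restrictT _ _).1 => //; exact: measurable_funTS.
exists (~` D); split => //; first exact: measurableC.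
move=> x /= nx Dx; apply: nx => _; rewrite patchE mem_set//.
Qed.

Lemma le_dist_Rintegral (f g : T -> R) (M e : R) :
  measurable_fun setT f -> measurable_fun setT g ->
  (forall x, `|f x| <= M) -> (forall x, `|g x| <= M) ->
  (\int[mu]_x `|f x - g x|%:E <= e%:E)%E ->
  `|\int[mu]_x f x - \int[mu]_x g x| <= e.
Proof.
move=> mf mg fM gM fg.
have iF := @bounded_integrable _ _ _ mu setT f M measurableT mf fM.
have ig := @bounded_integrable _ _ _ mu setT g M measurableT mg gM.
rewrite -RintegralB//; apply: le_trans (le_normr_Rintegral measurableT _) _.
  rewrite /comp; under eq_fun do rewrite EFinB.
  exact: (integrableB measurableT iF ig).
rewrite -lee_fin fineK// ge0_fin_numE; first exact: le_lt_trans fg (ltry _).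
by apply: integral_ge0 => x _; rewrite lee_fin.
Qed.

End Integrals.

(** * Density of bounded continuous functions in L1 *)

Section BoundedContinuous.
Context {R : realType} {T : ptopologicalType}.
Implicit Types f g : T -> R.

Lemma bounded_funP (S : Type) (f : S -> R) :
  bounded_fun f <-> exists M, forall x, `|f x| <= M.
Proof.
split=> [[M [_ fM]]|[M fM]].
  by exists (M + 1) => x; apply: fM => //; rewrite ltrDl.
by exists M; split=> [|N MN x _]; [exact: num_real|exact: le_trans (ltW MN)].
Qed.

Lemma CbP f : Cb f <-> continuous f /\ exists M, forall x, `|f x| <= M.
Proof. by split=> -[cf /bounded_funP bf]. Qed.

Lemma Cb_cst (c : R) : @Cb R T (fun=> c).
Proof. by apply/CbP; split; [exact: cst_continuous|exists `|c|]. Qed.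

Lemma Cb_lin (a b : R) f g : Cb f -> Cb g -> Cb (fun x => a * f x + b * g x).
Proof.
move=> /CbP[cf [M fM]] /CbP[cg [N gN]]; apply/CbP; split.
  by move=> x; apply: cvgD; apply: cvgM;
    [exact: cvg_cst|exact: cf|exact: cvg_cst|exact: cg].
exists (`|a| * M + `|b| * N) => x; apply: le_trans (ler_normD _ _) _.
by rewrite !normrM; apply: lerD; apply: ler_wpM2l.
Qed.

Lemma Cb_comp (h : R -> R) f : continuous h ->
  (forall M : R, exists N, forall y, `|y| <= M -> `|h y| <= N) ->
  Cb f -> Cb (h \o f).
Proof.
move=> ch bh /CbP[cf [M fM]]; apply/CbP; split.
  by move=> x; apply: continuous_comp; [exact: cf|exact: ch].
by have [N hN] := bh M; exists N => x; exact: hN.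
Qed.

Lemma Cb_expR f : Cb f -> Cb (fun x => expR (f x)).
Proof.
move=> Cf; apply: (Cb_comp _ _ Cf) => [x|M]; first exact: continuous_expR.
by exists (expR M) => y; exact: norm_expR_le.
Qed.

Lemma continuous_borel_measurable f : continuous f ->
  measurable_fun [set: borel T] (f : borel T -> R).
Proof.
move=> cf; apply: (measurability _ (RGenOInfty.measurableE R)).
move=> /= _ [_ [x ->] <-]; rewrite setTI; apply: sub_sigma_algebra.
by apply: open_comp => [y _|]; [exact: cf|exact: interval_open].
Qed.

Lemma Cb_measurable f : Cb f -> measurable_fun [set: borel T] (f : borel T -> R).
Proof. by move=> [cf _]; exact: continuous_borel_measurable. Qed.

End BoundedContinuous.

Section L1Approximation.
Context {R : realType} {T : ptopologicalType}.
Variable mu : {finite_measure set (borel T) -> \bar R}.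
Implicit Types f g h : borel T -> R.

(** Membership of [g] in the closure of [Cb] for the [L1] distance of [mu]. *)
Definition Cb_approx g : Prop := measurable_fun [set: borel T] g /\
  forall e : R, 0 < e -> exists2 f : T -> R, Cb f &
    (\int[mu]_x `|(f : borel T -> R) x - g x|%:E <= e%:E)%E.

Lemma Cb_approx_lin (a b : R) g h : Cb_approx g -> Cb_approx h ->
  Cb_approx (fun x => a * g x + b * h x).
Proof.
move=> [mg Ag] [mh Ah]; split.
  by apply: measurable_funD; apply: measurable_funM.
move=> e e0; pose c := `|a| + `|b| + 1; have c0 : 0 < c by rewrite ltr_wpDl.
have ec0 : 0 < e / c by rewrite divr_gt0.
have [f Cf fg] := Ag _ ec0; have [k Ck kh] := Ah _ ec0.
have mf := Cb_measurable Cf; have mk := Cb_measurable Ck.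
exists (fun x => a * f x + b * k x); first exact: Cb_lin.
apply: (@le_trans _ _ (\int[mu]_x
  (`|a|%:E * `|(f : borel T -> R) x - g x|%:E +
   `|b|%:E * `|(k : borel T -> R) x - h x|%:E))%E).
  apply: ge0_le_integral => //.
  - by apply: measurable_dist; apply: measurable_funD; apply: measurable_funM.
  - by apply: emeasurable_funD; apply: measurable_funeM; exact: measurable_dist.
  - move=> x _; rewrite -!EFinM -EFinD lee_fin -!normrM.
    by apply: le_trans (ler_normD _ _); rewrite le_eqVlt; apply/orP; left;
      apply/eqP; congr `| _ |; lra.
rewrite ge0_integralD//; try by apply: measurable_funeM; exact: measurable_dist.
rewrite !ge0_integralZl//; try exact: measurable_dist.
apply: (@le_trans _ _ (`|a|%:E * (e / c)%:E + `|b|%:E * (e / c)%:E)%E).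
  by apply: leeD; apply: lee_wpmul2l.
rewrite -!EFinM -EFinD lee_fin -mulrDl mulrCA -[leRHS]mulr1 ler_wpM2l ?(ltW e0)//.
by rewrite ler_pdivrMr // mul1r /c; lra.
Qed.

Lemma Cb_approx_closed g : measurable_fun [set: borel T] g ->
  (forall e : R, 0 < e -> exists2 h, Cb_approx h &
    (\int[mu]_x `|h x - g x|%:E <= e%:E)%E) ->
  Cb_approx g.
Proof.
move=> mg lim; split=> // e e0.
have e20 : 0 < e / 2 by rewrite divr_gt0.
have [h [mh /(_ _ e20)[f Cf fh]] hg] := lim _ e20.
have mf := Cb_measurable Cf.
exists f => //.
apply: (@le_trans _ _ (\int[mu]_x
  (`|(f : borel T -> R) x - h x|%:E + `|h x - g x|%:E))%E).
  apply: ge0_le_integral => //.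
  - exact: measurable_dist.
  - by apply: emeasurable_funD; exact: measurable_dist.
  - by move=> x _; rewrite -EFinD lee_fin ler_distD.
rewrite ge0_integralD//; try exact: measurable_dist.
by rewrite [e]splitr EFinD leeD.
Qed.

Lemma Cb_approx_Cb (f : T -> R) : Cb f -> Cb_approx f.
Proof.
move=> Cf; split; first exact: Cb_measurable.
move=> e e0; exists f => //; under eq_integral do rewrite subrr normr0.
by rewrite integral0 lee_fin ltW.
Qed.

(** Dominated convergence, with a constant as dominating function. *)
Lemma Cb_approx_lim (g_ : (borel T -> R)^nat) g (M : R) :
  (forall n, Cb_approx (g_ n)) -> measurable_fun [set: borel T] g ->
  (forall n x, `|g_ n x| <= M) -> (forall x, g_ ^~ x @ \oo --> g x) ->
  Cb_approx g.
Proof.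
move=> Ag mg gM gcvg; apply: Cb_approx_closed => // e e0.
have [] := @dominated_convergence _ _ _ mu setT measurableT
  (fun n => EFin \o g_ n) (EFin \o g) (cst M%:E).
- by move=> n; apply/measurable_EFinP; have [] := Ag n.
- exact/measurable_EFinP.
- by apply: aeW => x _; apply/fine_cvgP; split; [exact: nearW|exact: gcvg].
- by have := @bounded_integrable _ _ _ mu setT (cst M) `|M| measurableT;
    apply; [exact: measurable_cst|].
- by apply: aeW => x n _ /=; rewrite lee_fin.
move=> _ /fine_cvgP[fin /cvgrPdist_le/(_ _ e0) cvg0] _.
have [N _ HN] : \forall n \near \oo,
    (\int[mu]_x `|g_ n x - g x|%:E <= e%:E)%E.
  near=> n.
  have fn : (\int[mu]_x `|(EFin \o g_ n) x - (EFin \o g) x|)%E \is a fin_num.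
    by near: n.
  rewrite -(fineK fn) lee_fin.
  have : `|0 - fine (\int[mu]_x `|(EFin \o g_ n) x - (EFin \o g) x|)%E| <= e.
    by near: n.
  by rewrite sub0r normrN; apply: le_trans; exact: ler_norm.
by exists (g_ N) => //; exact: HN (leqnn N).
Unshelve. all: by end_near. Qed.

End L1Approximation.

Import HBSimple.

Section MetrizableApproximation.
Context {R : realType} {T : ptopologicalType}.

(** A (pseudo)metric inducing the topology of [T], as a bare function: the metric
    given by complete metrizability lives on a homeomorphic copy of [T], and this
    is what survives its transport to [T] itself. *)
Definition compatible_dist (d : T -> T -> R) : Prop :=
  [/\ forall x y, 0 <= d x y,
      forall x y z, d x z <= d x y + d y z,
      forall x y, d x y = d y x,
      forall x e, 0 < e -> \forall y \near x, d x y < e &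
      forall (U : set T) x, open U -> U x ->
        exists2 e, 0 < e & forall y, d x y < e -> U y].

Lemma completely_metrizable_dist : completely_metrizable R T ->
  exists d, compatible_dist d.
Proof.
move=> [M [phi [psi [_ phiK psiK cphi cpsi]]]].
exists (fun x y => mdist (phi x) (phi y)); split.
- by move=> x y; exact: mdist_ge0.
- by move=> x y z; exact: metric_triangle.
- by move=> x y; exact: metric_sym.
- move=> x e e0; have := nbhsx_ballx (phi x) e e0.
  by move=> /cphi; rewrite ballEmdist.
- move=> U x oU Ux; have : nbhs (phi x) (psi @^-1` U).
    by apply: cpsi; rewrite phiK; exact: open_nbhs_nbhs.
  move=> /nbhs_ballP[e /= e0 eU]; exists e => // y xy.
  by have := eU (phi y); rewrite ballEmdist /= phiK; exact.
Qed.

Variable mu : {finite_measure set (borel T) -> \bar R}.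

(** The functions [min 1 (n * r x)], with [r] the distance to the complement of
    [U], are continuous and converge to the indicator of [U]. *)
Lemma Cb_approx_open (d : T -> T -> R) (U : set T) : compatible_dist d ->
  open U -> Cb_approx mu (\1_U : borel T -> R).
Proof.
move=> [d0 dD dC dN dO] oU.
have [CU|/set0P[c0 Cc0]] := eqVneq (~` U) set0.
  have -> : \1_U = (fun=> 1) :> (borel T -> R).
    apply/funext => x; rewrite indicE mem_set//; apply: contrapT => Ux.
    by have : (~` U) x by []; rewrite CU.
  exact: Cb_approx_Cb (Cb_cst _).
pose D x := [set d x c | c in ~` U]; pose r x := inf (D x).
have D0 x : D x !=set0 by exists (d x c0), c0.
have Dlb x : lbound (D x) 0 by move=> _ [c _ <-].
have r_ge0 x : 0 <= r x by exact: lb_le_inf.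
have r_le x c : ~ U c -> r x <= d x c.
  by move=> Uc; apply: ge_inf; [exists 0|exists c].
have r_lip x y : r x <= d x y + r y.
  rewrite -lerBlDl; apply: lb_le_inf => // _ [c Uc <-].
  by rewrite lerBlDl; apply: le_trans (dD _ _ _); exact: r_le.
have cr : continuous (r : T -> R).
  move=> x; apply/cvgrPdist_lt => e e0; have := dN x e e0; apply: filterS => y xy.
  apply: le_lt_trans xy; rewrite ler_norml.
  by have := r_lip x y; have := r_lip y x; rewrite (dC y x); lra.
have r_gt0 x : U x -> 0 < r x.
  move=> Ux; have [e e0 eU] := dO _ _ oU Ux; apply: lt_le_trans e0 _.
  apply: lb_le_inf => // _ [c Uc <-]; rewrite leNgt; apply/negP => xc.
  exact: Uc (eU _ xc).
have r_eq0 x : ~ U x -> r x = 0.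
  move=> Ux; apply/eqP; rewrite eq_le r_ge0 andbT.
  apply: le_trans (r_le x x Ux) _; apply/ler_addgt0Pr => e e0; rewrite add0r.
  by rewrite ltW//; exact: nbhs_singleton (dN x e e0).
pose g (n : nat) x := Num.min 1 (n%:R * r x).
have g01 n x : 0 <= g n x <= 1.
  by rewrite /g le_min ler01 mulr_ge0//= ge_min lexx.
apply: (@Cb_approx_lim _ _ mu (fun n => g n : borel T -> R) _ 1).
- move=> n; apply: Cb_approx_Cb; apply/CbP; split.
    move=> x; apply: (@continuous_min R T (cst 1) (fun y => n%:R * r y)).
      exact: cvg_cst.
    by apply: cvgM; [exact: cvg_cst|exact: cr].
  by exists 1 => x; have /andP[g0 g1] := g01 n x; rewrite ger0_norm.
- by apply: measurable_indic; exact: sub_sigma_algebra.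
- by move=> n x; have /andP[g0 g1] := g01 n x; rewrite ger0_norm.
- move=> x; rewrite indicE; have [Ux|Ux] := pselect (U x); last first.
    rewrite memNset// (_ : (fun n => g n x) = cst 0); first exact: cvg_cst.
    by apply/funext => n; rewrite /g r_eq0// mulr0 min_r.
  rewrite mem_set//; apply: cvg_near_cst.
  near=> n; rewrite /g min_l// -ler_pdivrMr ?r_gt0//.
  near: n; exact: nbhs_infty_ger.
Unshelve. all: by end_near. Qed.

(** Open sets are stable under intersection, and the sets whose indicator is
    approximable form a lambda-system: proper differences are linear
    combinations of indicators, increasing unions are bounded limits. *)
Lemma Cb_approx_indic (d : T -> T -> R) (A : set (borel T)) :
  compatible_dist d -> measurable A -> Cb_approx mu (\1_A : borel T -> R).
Proof.
move=> dd; pose H := [set B : set (borel T) | measurable B /\ Cb_approx mu \1_B].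
suff : (<<s @open T>> : set (set (borel T))) `<=` H by move=> sub /sub[].
apply: lambda_system_subset => //.
- exact: openI.
- split => //.
  + by split=> //; apply: Cb_approx_open dd _; exact: openT.
  + move=> B C CB [mB AB] [mC AC]; split; first exact: measurableD.
    have -> : \1_(B `\` C) = (fun x => 1 * \1_B x + -1 * \1_C x) :> (_ -> R).
      apply/funext => x; rewrite !indicE.
      have [Cx|Cx] := pselect (C x).
        rewrite (mem_set Cx) (mem_set (CB _ Cx)) memNset => [|[]//].
        by rewrite mulN1r mul1r subrr.
      have [Bx|Bx] := pselect (B x).
        by rewrite (memNset Cx) (mem_set Bx) mem_set// mulr0 addr0 mul1r.
      by rewrite (memNset Cx) (memNset Bx) memNset ?mulr0 ?addr0// => -[].
    exact: Cb_approx_lin.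
  + move=> F ndF HF; have mF n : measurable (F n) by have [] := HF n.
    split; first exact: bigcupT_measurable.
    apply: (@Cb_approx_lim _ _ mu (fun n => \1_(F n)) _ 1).
    * by move=> n; have [] := HF n.
    * by apply: measurable_indic; exact: bigcupT_measurable.
    * by move=> n x; rewrite indicE; case: (_ \in _); rewrite ?normr1 ?normr0.
    * move=> x; rewrite indicE; have [[k _ Fx]|Fx] := pselect ((\bigcup_n F n) x).
        rewrite mem_set; last by exists k.
        apply: cvg_near_cst; near=> n; rewrite indicE mem_set//.
        suff /subsetPset : (F k <= F n)%O by exact.
        by apply: ndF; near: n; exact: nbhs_infty_ge.
      rewrite memNset// (_ : (fun n => _) = cst 0); first exact: cvg_cst.
      by apply/funext => n; rewrite indicE memNset// => Fnx; apply: Fx; exists n.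
- move=> U oU; split; first exact: sub_sigma_algebra.
  exact: Cb_approx_open dd oU.
Unshelve. all: by end_near. Qed.

Lemma Cb_approx_bounded (d : T -> T -> R) (g : borel T -> R) (M : R) :
  compatible_dist d -> measurable_fun setT g -> (forall x, `|g x| <= M) ->
  Cb_approx mu g.
Proof.
move=> dd mg gM; apply: Cb_approx_closed => // e e0.
have ig := @bounded_integrable _ _ _ mu setT g M measurableT mg gM.
have [s [is_ _ /fine_cvgP[fin /cvgrPdist_le/(_ _ e0) cvg0]]] :=
  approximation_sfun_integrable measurableT ig.
have [N _ HN] : \forall n \near \oo,
    (\int[mu]_x `|s n x - g x|%:E <= e%:E)%E.
  near=> n.
  under eq_integral do rewrite distrC.
  have fn : (\int[mu]_x `|(EFin \o g) x - (s n x)%:E|)%E \is a fin_num.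
    by near: n.
  rewrite -(fineK fn) lee_fin.
  have : `|0 - fine (\int[mu]_x `|(EFin \o g) x - (s n x)%:E|)%E| <= e.
    by near: n.
  by rewrite sub0r normrN; apply: le_trans; exact: ler_norm.
exists (s N); last exact: HN (leqnn N).
have -> : (s N : borel T -> R) =
    (fun x => \sum_(y <- fset_set (range (s N))) y * \1_(s N @^-1` [set y]) x).
  by apply/funext => x; rewrite fimfunE fsbig_finite.
elim: (enum_fset _) => [|y l IH].
  by under eq_fun do rewrite big_nil; exact: Cb_approx_Cb (Cb_cst _).
under eq_fun do rewrite big_cons -[X in _ + X]mul1r.
apply: Cb_approx_lin => //; apply: Cb_approx_indic dd _.
by rewrite -[X in measurable X]setTI; exact: measurable_funP.
Unshelve. all: by end_near. Qed.

(** Truncating an approximant to the range of [g] only brings it closer to [g].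
    The common bound matters because the exponential is Lipschitz on bounded
    sets only. *)
Lemma Cb_approx_clamp (g : borel T -> R) (M e : R) : 0 < e ->
  (forall x, `|g x| <= M) -> Cb_approx mu g ->
  exists f : T -> R, [/\ Cb f, forall x, `|f x| <= M &
    (\int[mu]_x `|(f : borel T -> R) x - g x|%:E <= e%:E)%E].
Proof.
move=> e0 gM [mg /(_ _ e0)[f Cf fg]].
pose h (y : R) := Num.max (- M) (Num.min M y).
have M0 : 0 <= M := le_trans (normr_ge0 _) (gM point).
have hM y : `|h y| <= M.
  by rewrite ler_norml /h le_max lexx /= ge_max ge_min lexx /= andbT; lra.
have Ch : Cb (h \o f).
  apply: Cb_comp Cf; last by move=> N; exists M.
  move=> y; apply: (@continuous_max R R (cst (- M)) (fun y => Num.min M y)).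
    exact: cvg_cst.
  by apply: (@continuous_min R R (cst M) id); [exact: cvg_cst|exact: cvg_id].
exists (h \o f); split => [//|x|]; first exact: hM.
have mf := Cb_measurable Cf; have mh := Cb_measurable Ch.
apply: le_trans fg; apply: ge0_le_integral => //.
- by apply/measurable_EFinP/measurableT_comp => //; exact: measurable_funB.
- by apply/measurable_EFinP/measurableT_comp => //; exact: measurable_funB.
move=> x _; rewrite lee_fin.
suff clamp (y z : R) : `|z| <= M -> `|h y - z| <= `|y - z| by exact: clamp.
rewrite ler_norml => /andP[z1 z2].
have := ler_norm (y - z); have := ler_norm (z - y); rewrite (distrC z y).
rewrite ler_norml /h /Num.max /Num.min.
by case: (ltP M y) => ?; case: ltP => ?; lra.
Qed.

End MetrizableApproximation.

(** * The entropy gap and its structure *)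

Section FiniteMeasureAdd.
Context d (T : measurableType d) (R : realType).
Variables mu nu : {finite_measure set T -> \bar R}.

Let measure_add_fin : fin_num_fun (measure_add mu nu).
Proof. by move=> A mA; rewrite measure_addE fin_numD !fin_num_measure. Qed.

HB.instance Definition _ := Measure.on (measure_add mu nu).
HB.instance Definition _ :=
  Measure_isFinite.Build _ _ _ (measure_add mu nu) measure_add_fin.

End FiniteMeasureAdd.

Section EntropyGap.
Context d (T : measurableType d) (R : realType).
Implicit Types P Q : probability T R.

(** The functional of the Donsker-Varadhan formula with the logarithm of the
    exponential moment replaced by its tangent bound [log y <= y - 1]. The
    supremum over [f] is still the relative entropy, and the functional becomes
    affine in the pair [(P, Q)]. *)
Definition entropy_gap Q P (f : T -> R) : R :=
  \int[Q]_x f x - \int[P]_x expR (f x) + 1.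

Variables P Q : probability T R.

(** On a [P]-null set [A] the exponential moment does not see the test function
    [n * 1_A], so the gap equals [n * Q A], which is bounded in [n] only when
    [Q A = 0]. *)
Lemma entropy_gap_dominates (r : R) :
  (forall (g : T -> R) (M : R), measurable_fun setT g ->
    (forall x, `|g x| <= M) -> entropy_gap Q P g <= r) ->
  Q `<< P.
Proof.
move=> gap_le; apply/null_content_dominatesP => A mA PA0.
apply: contrapT => QA.
have QA0 : 0 < fine (Q A).
  rewrite fine_gt0// lt0e measure_ge0 andbT ltey_eq fin_num_measure// andbT.
  exact/eqP.
pose chi : T -> R := \1_A.
have chi01 x : chi x = 0 \/ chi x = 1.
  by rewrite /chi indicE; case: (_ \in _); [right|left].
have ichi (mu : probability T R) : mu.-integrable setT (EFin \o chi).
  by apply: integrable_indic.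
have intchi (mu : probability T R) : \int[mu]_x chi x = fine (mu A).
  by rewrite /Rintegral integral_indic// setIT.
pose n := Num.truncn (r / fine (Q A)).
have exp_chi : \int[P]_x expR (n.+1%:R * chi x) = 1.
  transitivity (\int[P]_x (1 + (expR n.+1%:R - 1) * chi x)).
    apply: eq_Rintegral => x _.
    by have [->|->] := chi01 x; rewrite ?mulr1 ?mulr0 ?expR0 ?addr0 // addrC subrK.
  have i1 : P.-integrable setT (EFin \o cst (1 : R)).
    exact: finite_measure_integrable_cst.
  rewrite RintegralD//.
  - rewrite (RintegralZl _ measurableT (ichi P)) intchi PA0 /= mulr0 addr0.
    rewrite Rintegral_cst// mul1r.
    by have /= -> := probability_setT P.
  - rewrite /comp; under eq_fun do rewrite EFinM.
    exact: (integrableZl measurableT _ (ichi P)).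
have := gap_le (fun x => n.+1%:R * chi x) n.+1%:R.
rewrite /entropy_gap exp_chi (RintegralZl _ measurableT (ichi Q)) intchi subrK.
have mchi : measurable_fun setT chi by exact: measurable_indic.
have nchi x : `|n.+1%:R * chi x| <= n.+1%:R.
  by have [->|->] := chi01 x; rewrite ?mulr1 ?mulr0 ?normr0 ?ger0_norm.
move=> /(_ (measurable_funM (measurable_cst _) mchi) nchi).
by rewrite leNgt -ltr_pdivrMr// => /negP; apply; exact: truncnS_gt.
Qed.

End EntropyGap.

Section GapStructure.
Context d (T : measurableType d) (R : realType).
Implicit Types P Q : probability T R.

(** Adding the constant [M] makes the integrand nonnegative, where integrals are
    additive and homogeneous in the measure. *)
Lemma Rintegral_mixture P P0 P1 (t M : R) (f : T -> R) : 0 <= t <= 1 ->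
  (forall A, measurable A -> P A = ((1 - t)%:E * P0 A + t%:E * P1 A)%E) ->
  measurable_fun setT f -> (forall x, `|f x| <= M) ->
  \int[P]_x f x = (1 - t) * \int[P0]_x f x + t * \int[P1]_x f x.
Proof.
move=> /andP[t0 t1] PE mf fM.
have s0 : 0 <= 1 - t by rewrite subr_ge0.
have if_ (mu : probability T R) : mu.-integrable setT (EFin \o f).
  exact: (@bounded_integrable _ _ _ mu setT f M).
have ic (mu : probability T R) : mu.-integrable setT (EFin \o cst M).
  exact: finite_measure_integrable_cst.
have shift (mu : probability T R) :
    (\int[mu]_x (f x + M)%:E = (\int[mu]_x f x + M)%:E)%E.
  have -> : \int[mu]_x f x + M = \int[mu]_x (f x + M).
    rewrite (RintegralD measurableT (if_ mu) (ic mu)) Rintegral_cst//.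
    by have /= -> := probability_setT mu; rewrite mulr1.
  rewrite /Rintegral fineK//; apply: integrable_fin_num => //.
  rewrite /comp; under eq_fun do rewrite EFinD.
  exact: (integrableD measurableT (if_ mu) (ic mu)).
have f_ge0 x : (0 <= (f x + M)%:E)%E.
  by rewrite lee_fin; have := fM x; rewrite ler_norml; lra.
have mfM : measurable_fun setT (fun x => (f x + M)%:E).
  by apply/measurable_EFinP; exact: measurable_funD.
have : (\int[P]_x (f x + M)%:E =
    (1 - t)%:E * \int[P0]_x (f x + M)%:E + t%:E * \int[P1]_x (f x + M)%:E)%E.
  rewrite (eq_measure_integral
    (measure_add (mscale (NngNum s0) P0) (mscale (NngNum t0) P1))); last first.
    move=> A mA _; apply: etrans (PE A mA) _; apply: esym.
    exact: (measure_addE (mscale (NngNum s0) P0) (mscale (NngNum t0) P1) A).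
  by rewrite ge0_integral_measure_add// !ge0_integral_mscale.
rewrite !shift -!EFinM -EFinD => -[]; lra.
Qed.

Lemma entropy_gap_concave P Q (f g : T -> R) (M t : R) : 0 <= t <= 1 ->
  measurable_fun setT f -> measurable_fun setT g ->
  (forall x, `|f x| <= M) -> (forall x, `|g x| <= M) ->
  (1 - t) * entropy_gap Q P f + t * entropy_gap Q P g <=
  entropy_gap Q P (fun x => (1 - t) * f x + t * g x).
Proof.
move=> t01 mf mg fM gM; have /andP[t0 t1] := t01.
have ib (mu : probability T R) (h : T -> R) N : measurable_fun setT h ->
    (forall x, `|h x| <= N) -> mu.-integrable setT (EFin \o h).
  by move=> mh hN; exact: (@bounded_integrable _ _ _ mu setT h N).
have mexp (h : T -> R) : measurable_fun setT h ->
    measurable_fun setT (fun x => expR (h x)).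
  by move=> mh; exact: measurableT_comp.
have expM (h : T -> R) : (forall x, `|h x| <= M) ->
    forall x, `|expR (h x)| <= expR M.
  by move=> hM x; exact: norm_expR_le.
pose k x := (1 - t) * f x + t * g x.
have kM x : `|k x| <= M.
  apply: le_trans (ler_normD _ _) _.
  rewrite !normrM (ger0_norm t0) ger0_norm ?subr_ge0//.
  by have := fM x; have := gM x; nra.
have mk : measurable_fun setT k.
  by apply: measurable_funD; exact: measurable_funM.
have lin (mu : probability T R) (h l : T -> R) (N : R) :
    measurable_fun setT h -> measurable_fun setT l ->
    (forall x, `|h x| <= N) -> (forall x, `|l x| <= N) ->
    \int[mu]_x ((1 - t) * h x + t * l x) =
      (1 - t) * \int[mu]_x h x + t * \int[mu]_x l x.
  move=> mh ml hN lN; have ih := ib mu h N mh hN; have il := ib mu l N ml lN.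
  rewrite -(RintegralZl _ measurableT ih) -(RintegralZl _ measurableT il).
  rewrite RintegralD//.
  - rewrite /comp; under eq_fun do rewrite EFinM.
    exact: (integrableZl measurableT).
  - rewrite /comp; under eq_fun do rewrite EFinM.
    exact: (integrableZl measurableT).
rewrite /entropy_gap (lin Q f g M)//.
have : \int[P]_x expR (k x) <=
    \int[P]_x ((1 - t) * expR (f x) + t * expR (g x)).
  apply: le_Rintegral => //.
  - exact: ib (mexp _ mk) (expM _ kM).
  - apply: (ib _ _ (expR M)).
      by apply: measurable_funD; apply: measurable_funM => //; exact: mexp.
    move=> x; apply: le_trans (ler_normD _ _) _.
    rewrite !normrM (ger0_norm t0) (ger0_norm (_ : 0 <= 1 - t)) ?subr_ge0//.
    by have := expM _ fM x; have := expM _ gM x; nra.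
  - by move=> x _; exact: expR_convex.
rewrite (lin P _ _ (expR M) (mexp _ mf) (mexp _ mg) (expM _ fM) (expM _ gM)).
by rewrite /k; lra.
Qed.

End GapStructure.

(** * Relative entropy is at most the supremum of the gap *)

Section DonskerVaradhan.
Context {R : realType} {T : ptopologicalType}.
Variables (P Q : M1 R T) (d : T -> T -> R).
Hypothesis dd : compatible_dist d.

(** A bounded measurable test function is replaced by a bounded continuous one
    that is close to it in [L1 (P + Q)]: both integrals in the gap are Lipschitz
    for that distance on uniformly bounded functions. *)
Lemma entropy_gap_bounded (r : R) :
  (forall f : T -> R, Cb f -> entropy_gap Q P f <= r) ->
  forall (g : borel T -> R) (M : R), measurable_fun setT g ->
    (forall x, `|g x| <= M) -> entropy_gap Q P g <= r.
Proof.
move=> gap_le g M mg gM; apply/ler_addgt0Pr => e e0.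
pose K := 1 + expR M; have K0 : 0 < K by rewrite ltr_wpDr ?expR_ge0.
have eK0 : 0 < e / K by rewrite divr_gt0.
pose mu : {finite_measure set (borel T) -> \bar R} := measure_add P Q.
have [f [Cf fM fg]] :=
  Cb_approx_clamp eK0 gM (@Cb_approx_bounded _ _ mu d g M dd mg gM).
have mf : measurable_fun setT (f : borel T -> R) := Cb_measurable Cf.
have mfg : measurable_fun [set: borel T]
    (fun x : borel T => `|(f : borel T -> R) x - g x|%:E).
  exact: (measurable_dist mf mg).
have fg0 (nu : M1 R T) : (0 <= \int[nu]_x `|(f : borel T -> R) x - g x|%:E)%E.
  by apply: integral_ge0 => x _; rewrite lee_fin.
move: fg; rewrite /mu ge0_integral_measure_add// => fg.
have fgP : (\int[P]_x `|(f : borel T -> R) x - g x|%:E <= (e / K)%:E)%E.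
  by apply: (le_trans _ fg); rewrite leeDl ?fg0.
have fgQ : (\int[Q]_x `|(f : borel T -> R) x - g x|%:E <= (e / K)%:E)%E.
  by apply: (le_trans _ fg); rewrite leeDr ?fg0.
have dQ : `|\int[Q]_x (f : borel T -> R) x - \int[Q]_x g x| <= e / K.
  exact: (@le_dist_Rintegral _ _ _ Q _ _ M).
have dP : `|\int[P]_x expR ((f : borel T -> R) x) - \int[P]_x expR (g x)|
    <= expR M * (e / K).
  apply: (@le_dist_Rintegral _ _ _ P _ _ (expR M)).
  - exact: measurableT_comp.
  - exact: measurableT_comp.
  - by move=> x; exact: norm_expR_le.
  - by move=> x; exact: norm_expR_le.
  apply: (@le_trans _ _ (\int[P]_x
      ((expR M)%:E * `|(f : borel T -> R) x - g x|%:E))%E).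
    apply: ge0_le_integral => //.
    - by apply: measurable_dist; exact: measurableT_comp.
    - exact: measurable_funeM.
    - by move=> x _; rewrite -EFinM lee_fin; exact: expR_lipschitz.
  rewrite ge0_integralZl// ?lee_fin ?expR_ge0//.
  by rewrite EFinM; apply: lee_wpmul2l => //; rewrite lee_fin expR_ge0.
have KE : e / K + expR M * (e / K) = e.
  by rewrite -[X in X + _]mul1r -mulrDl mulrC divfK ?gt_eqF.
have := gap_le f Cf; rewrite /entropy_gap.
by move: dQ dP; rewrite !ler_norml => /andP[? ?] /andP[? ?]; lra.
Qed.

End DonskerVaradhan.

Section Density.
Local Open Scope ereal_scope.
Local Open Scope charge_scope.
Context d (T : measurableType d) (R : realType).
Implicit Types P Q : probability T R.

(** A version [Z] of [dQ/dP] with real values, positive [Q]-almost everywhere, so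
    that every later computation with [ln (Z x)] takes place on the set where [Z]
    is positive and needs no almost-everywhere argument. *)
Lemma density_exists P Q : Q `<< P ->
  exists Z : T -> R, [/\ measurable_fun setT Z, forall x, (0 <= Z x)%R,
    Q (~` [set x | (0 < Z x)%R]) = 0,
    \int[Q]_x lne (('d (charge_of_finite_measure Q) '/d P) x) =
      \int[Q]_(x in [set x | (0 < Z x)%R]) (ln (Z x))%:E &
    forall h D, (forall x, 0 <= h x) -> measurable_fun setT h -> measurable D ->
      \int[Q]_(x in D) h x = \int[P]_(x in D) (h x * (Z x)%:E)].
Proof.
move=> QP; pose f := Radon_Nikodym_SigmaFinite.f Q P.
pose Z x := fine (f x).
have f_fin x : f x \is a fin_num := Radon_Nikodym_SigmaFinite.f_fin_num QP x.
have f_ge0 x : 0 <= f x := Radon_Nikodym_SigmaFinite.f_ge0 QP x.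
have fE x : f x = (Z x)%:E by rewrite fineK.
have Z0 x : (0 <= Z x)%R by exact: fine_ge0.
have mf : measurable_fun setT f.
  exact: measurable_int (Radon_Nikodym_SigmaFinite.f_integrable QP).
have mZ : measurable_fun setT Z by exact: measurableT_comp.
set D := [set x | (0 < Z x)%R].
have mD : measurable D.
  rewrite [D](_ : _ = Z @^-1` `]0%R, +oo[); last first.
    by apply/seteqP; split=> x /=; rewrite in_itv/= andbT.
  by rewrite -[X in measurable X]setTI; exact: mZ.
have QD : Q (~` D) = 0.
  rewrite (Radon_Nikodym_SigmaFinite.f_integral QP); last exact: measurableC.
  apply: integral0_eq => x /= /negP; rewrite -leNgt => Zx.
  by rewrite -/f fE; congr EFin; apply/eqP; rewrite eq_le Zx Z0.
have mRN : measurable_fun setT ('d (charge_of_finite_measure Q) '/d P).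
  apply: (measurable_int P); exact: Radon_Nikodym_integrable.
exists Z; split => //.
- rewrite [LHS](@ae_eq_integral _ _ _ Q setT (fun x => lne (f x)))//.
  + rewrite (integral_full_set mD QD)//; last first.
      by apply: measurableT_comp mf; exact: measurable_lne.
    by apply: eq_integral => x /set_mem Dx; rewrite fE lne_EFin.
  + by apply: measurableT_comp mRN; exact: measurable_lne.
  + by apply: measurableT_comp mf; exact: measurable_lne.
  + apply: (null_dominates_ae_eq measurableT QP).
    have := ae_eq_Radon_Nikodym_SigmaFinite QP measurableT.
    by apply: filterS => x /= H /H /esym ->.
- move=> h E h0 mh mE.
  rewrite -(Radon_Nikodym_SigmaFinite.change_of_variables QP h0 mE).
    by apply: eq_integral => x _; rewrite -/f fE.
  exact: measurable_funTS.
Qed.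

End Density.

Section TruncatedLog.
Context {R : realType}.
Implicit Types a b z : R.

(** The logarithm of a value truncated to [[a, b]] is the truncated positive part
    minus the truncated negative part, since [1] lies between [a] and [b]. *)
Lemma ln_clampE a b z : 0 < a <= 1 -> 1 <= b ->
  ln (Num.max a (Num.min b z)) =
  ln (Num.max 1 (Num.min b z)) - (- ln (Num.max a (Num.min 1 z))).
Proof.
move=> /andP[a0 a1] b1; rewrite opprK; have [z1|z1] := leP z 1.
  by rewrite (min_r (le_trans z1 b1)) (max_l z1) ln1 add0r.
have mz : 1 <= Num.min b z by rewrite le_min b1 ltW.
by rewrite (max_r mz) (max_r (le_trans a1 mz)) (max_r a1) ln1 addr0.
Qed.

Lemma ln_max1_ge0 z : 0 <= ln (Num.max 1 z).
Proof. by rewrite ln_ge0// le_max lexx. Qed.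

Lemma ln_min1_le0 z : ln (Num.min 1 z) <= 0.
Proof. by rewrite ln_le0// ge_min lexx. Qed.

Lemma ln_max1 z : 0 < z -> ln (Num.max 1 z) = Num.max (ln z) 0.
Proof.
move=> z0; have [z1|z1] := leP z 1.
  by rewrite ln1 max_r// ln_le0.
by rewrite max_l// ln_ge0// ltW.
Qed.

Lemma ln_min1 z : 0 < z -> - ln (Num.min 1 z) = Num.max (- ln z) 0.
Proof.
move=> z0; have [z1|z1] := leP z 1.
  by rewrite max_l// oppr_ge0 ln_le0.
by rewrite ln1 oppr0 max_r// oppr_le0 ln_ge0// ltW.
Qed.

End TruncatedLog.

Section EntropyUpperBound.
Local Open Scope ereal_scope.
Context d (T : measurableType d) (R : realType).
Variables (P Q : probability T R) (Z : T -> R) (r : R).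
Let D := [set x | (0 < Z x)%R].
Hypothesis mZ : measurable_fun setT Z.
Hypothesis Z_ge0 : forall x, (0 <= Z x)%R.
Hypothesis QD : Q (~` D) = 0.
Hypothesis QE : forall h E, (forall x, 0 <= h x) -> measurable_fun setT h ->
  measurable E -> \int[Q]_(x in E) h x = \int[P]_(x in E) (h x * (Z x)%:E).
Hypothesis gap_le : forall (g : T -> R) (M : R), measurable_fun setT g ->
  (forall x, `|g x| <= M)%R -> (entropy_gap Q P g <= r)%R.

Lemma measurable_density_support : measurable D.
Proof.
rewrite [D](_ : _ = Z @^-1` `]0%R, +oo[); last first.
  by apply/seteqP; split=> x /=; rewrite in_itv/= andbT.
by rewrite -[X in measurable X]setTI; exact: mZ.
Qed.
Let mD := measurable_density_support.

Let mmax (c : R) (f : T -> R) : measurable_fun setT f ->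
  measurable_fun setT (fun x => Num.max c (f x)).
Proof. by move=> mf; exact: measurable_maxr. Qed.

Let mmin (c : R) (f : T -> R) : measurable_fun setT f ->
  measurable_fun setT (fun x => Num.min c (f x)).
Proof. by move=> mf; exact: measurable_minr. Qed.

Let mln (f : T -> R) : measurable_fun setT f ->
  measurable_fun setT (fun x => ln (f x)).
Proof. by move=> mf; exact: measurableT_comp (@measurable_ln R) mf. Qed.

Let N := \int[Q]_(x in D) (- ln (Num.min 1 (Z x)))%:E.

(** Test function: the logarithm of [Z] truncated to [[a, b]]. Its exponential is
    at most [a + Z], whose [P]-integral is [a + 1], so the hypothesis bounds the
    [Q]-integral of the truncated logarithm by [r + a]. *)
Lemma truncated_entropy_le (a b : R) : (0 < a <= 1)%R -> (1 <= b)%R ->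
  \int[Q]_(x in D) (ln (Num.max 1 (Num.min b (Z x))))%:E <= (r + a)%:E + N.
Proof.
move=> a01 b1; have /andP[a0 a1] := a01.
pose W x := Num.max a (Num.min b (Z x)).
pose p x := ln (Num.max 1%R (Num.min b (Z x))).
pose q x := (- ln (Num.max a (Num.min 1 (Z x))))%R.
have W0 x : (0 < W x)%R by rewrite lt_max a0.
have mW : measurable_fun setT W by apply: mmax; exact: mmin.
have mp : measurable_fun setT p by apply/mln/mmax; exact: mmin.
have mq : measurable_fun setT q.
  by apply: measurableT_comp => //; apply/mln/mmax; exact: mmin.
have p_ge0 x : (0 <= p x)%R by exact: ln_max1_ge0.
have q_ge0 x : (0 <= q x)%R.
  by rewrite oppr_ge0 ln_le0// ge_max a1 ge_min lexx.
have p_le x : (`|p x| <= ln b)%R.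
  rewrite ger0_norm// ler_ln ?posrE; first by rewrite ge_max b1 ge_min lexx.
    by rewrite lt_max ltr01.
  exact: lt_le_trans b1.
have q_le x : (`|q x| <= - ln a)%R.
  by rewrite ger0_norm// lerN2 ler_ln ?posrE ?lt_max ?a0// le_max lexx.
have ip := @bounded_integrable _ _ _ Q setT p _ measurableT mp p_le.
have iq := @bounded_integrable _ _ _ Q setT q _ measurableT mq q_le.
have lnWE x : ln (W x) = (p x - q x)%R by exact: ln_clampE.
have WP : (\int[P]_x expR (ln (W x)) <= a + 1)%R.
  have W_le : \int[P]_x (expR (ln (W x)))%:E <= (a + 1)%:E.
    apply: (@le_trans _ _ (\int[P]_x (a%:E + (Z x)%:E))).
      apply: ge0_le_integral ; first exact: measurableT.
      - by move=> x _; rewrite lee_fin expR_ge0.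
      - by apply/measurable_EFinP/measurableT_comp => //; exact: mln.
      - by apply: emeasurable_funD => //; exact/measurable_EFinP.
      move=> x _; rewrite lnK ?posrE// -EFinD lee_fin /W ge_max.
      by rewrite lerDl Z_ge0/= ge_min lerDr (ltW a0) orbT.
    rewrite ge0_integralD//=; last 3 first.
    - by move=> x _; rewrite lee_fin ltW.
    - by move=> x _; rewrite lee_fin.
    - exact/measurable_EFinP.
    rewrite integral_cst// EFinD leeD//.
      by have /= -> := probability_setT P; rewrite mule1.
    have := @QE (cst 1) setT (fun=> lee01) (measurable_cst _) measurableT.
    rewrite integral_cst// mul1e; have /= -> := probability_setT Q.
    by under eq_integral do rewrite mul1e; move=> <-.
  rewrite -lee_fin /Rintegral fineK// ge0_fin_numE.
    exact: le_lt_trans W_le (ltry _).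
  by apply: integral_ge0 => x _; rewrite lee_fin expR_ge0.
have gW : (\int[Q]_x p x <= r + a + \int[Q]_x q x)%R.
  have mg : measurable_fun setT (fun x => ln (W x)) by exact: mln.
  have g_le x : (`|ln (W x)| <= ln b - ln a)%R.
    rewrite lnWE; apply: le_trans (ler_normB _ _) _.
    exact: lerD (p_le x) (q_le x).
  have := gap_le mg g_le; rewrite /entropy_gap.
  rewrite [X in (X - _ + _ <= _)%R -> _](_ : _ =
      \int[Q]_x p x - \int[Q]_x q x)%R; last first.
    by rewrite -RintegralB//; apply: eq_Rintegral => x _; exact: lnWE.
  by move: WP; lra.
have pE : \int[Q]_x (p x)%:E = (\int[Q]_x p x)%R%:E.
  by rewrite /Rintegral fineK//; exact: integrable_fin_num ip.
have qE : \int[Q]_x (q x)%:E = (\int[Q]_x q x)%R%:E.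
  by rewrite /Rintegral fineK//; exact: integrable_fin_num iq.
rewrite -(integral_full_set mD QD); last exact/measurable_EFinP.
rewrite pE; apply: (@le_trans _ _ ((r + a)%:E + \int[Q]_x (q x)%:E)).
  by rewrite qE -EFinD lee_fin.
apply: leeD => //.
rewrite (integral_full_set mD QD); last exact/measurable_EFinP.
apply: ge0_le_integral => //.
- by move=> x _; rewrite lee_fin.
- by apply: measurable_funTS; exact/measurable_EFinP.
- apply: measurable_funTS; apply/measurable_EFinP/measurableT_comp => //.
  by apply: mln; exact: mmin.
- move=> x /= Zx; rewrite lee_fin lerN2.
  rewrite ler_ln ?posrE ?lt_max ?lt_min ?ltr01 ?Zx ?orbT//.
  by rewrite le_max lexx orbT.
Qed.

(** Removal of the truncations: [a] tends to [0] and [b] to infinity, the latter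
    by monotone convergence on the positive part. If the negative part has
    infinite integral, the left-hand side is [-oo] by convention. *)
Lemma integral_ln_density_le : \int[Q]_(x in D) (ln (Z x))%:E <= r%:E.
Proof.
have posE : \int[Q]_(x in D) (fun x => (ln (Z x))%:E)^\+ x =
    \int[Q]_(x in D) (ln (Num.max 1 (Z x)))%:E.
  apply: eq_integral => x /set_mem /= Zx.
  by rewrite funeposE -EFin_max ln_max1.
have negE : \int[Q]_(x in D) (fun x => (ln (Z x))%:E)^\- x = N.
  apply: eq_integral => x /set_mem /= Zx.
  by rewrite funenegE -EFinN -EFin_max ln_min1.
rewrite integralE posE negE.
have N0 : 0 <= N.
  by apply: integral_ge0 => x _; rewrite lee_fin oppr_ge0 ln_min1_le0.
have [->|] := eqVneq N +oo; first by rewrite addeNy leNye.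
rewrite -ltey => Noo; have Nfin : N \is a fin_num by rewrite ge0_fin_numE.
rewrite leeBlDr//.
pose p (n : nat) x : \bar R := (ln (Num.max 1 (Num.min n.+1%:R (Z x))))%:E.
have -> : \int[Q]_(x in D) (ln (Num.max 1 (Z x)))%:E =
    \int[Q]_(x in D) (limn (p ^~ x)).
  apply: eq_integral => x _; apply/esym/cvg_lim => //.
  apply: cvg_near_cst; near=> n; rewrite /p; congr (ln (Num.max _ _))%:E.
  rewrite min_r// ltW// (lt_le_trans (truncnS_gt _))// ler_nat ltnS.
  by near: n; exact: nbhs_infty_ge.
have p0 n x : 0 <= p n x by rewrite lee_fin ln_max1_ge0.
have p_nd x : {homo p ^~ x : n m / (n <= m)%N >-> n <= m}.
  move=> n m nm; rewrite lee_fin ler_ln ?posrE ?lt_max ?ltr01//.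
  rewrite ge_max !le_max lexx/= le_min !ge_min lexx orbT andbT.
  by rewrite ler_nat ltnS nm /= orbT.
rewrite monotone_convergence//; last first.
  move=> n; apply: measurable_funTS; apply/measurable_EFinP/mln/mmax.
  exact: mmin.
apply: lime_le.
  apply: ereal_nondecreasing_is_cvgn => n m nm.
  apply: ge0_le_integral => //.
  - by apply: measurable_funTS; apply/measurable_EFinP/mln/mmax; exact: mmin.
  - by apply: measurable_funTS; apply/measurable_EFinP/mln/mmax; exact: mmin.
  - by move=> x _; exact: p_nd.
apply: nearW => n; apply/lee_addgt0Pr => e e0.
have a01 : (0 < Num.min e 1 <= 1)%R by rewrite lt_min e0 ltr01 ge_min lexx orbT.
apply: (le_trans (truncated_entropy_le a01 _)); first by rewrite ler1n.
rewrite -(fineK Nfin) -!EFinD lee_fin addrAC lerD2l ge_min lexx//.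
Unshelve. all: by end_near. Qed.

End EntropyUpperBound.

(** * Expected logarithms are at most the relative entropy *)

Section EntropyLowerBound.
Local Open Scope ereal_scope.
Context d (T : measurableType d) (R : realType).
Variables (P Q : probability T R) (Z : T -> R) (X : T -> \bar R).
Let D := [set x | (0 < Z x)%R].
Hypothesis mZ : measurable_fun setT Z.
Hypothesis QD : Q (~` D) = 0.
Hypothesis QE : forall h E, (forall x, 0 <= h x) -> measurable_fun setT h ->
  measurable E -> \int[Q]_(x in E) h x = \int[P]_(x in E) (h x * (Z x)%:E).
Hypothesis mX : measurable_fun setT X.
Hypothesis X_ge0 : forall x, 0 <= X x.
Hypothesis PX : \int[P]_x X x <= 1.
Let mD := measurable_density_support mZ.

(** On the support, [w] is [1 / Z]; this form is measurable everywhere. *)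
Let w x := expR (- ln (Z x)).

Let mlnZ : measurable_fun setT (fun x => ln (Z x)).
Proof. exact: measurableT_comp (@measurable_ln R) mZ. Qed.

Let mw : measurable_fun setT (fun x => (w x)%:E).
Proof.
apply/measurable_EFinP/measurableT_comp => //.
exact: measurableT_comp.
Qed.

(** Change of variables: [Y / Z] has the same [Q]-integral over the support of
    [Z] as [Y] has under [P]. *)
Lemma integral_quotient_le (Y : T -> \bar R) : measurable_fun setT Y ->
  (forall x, 0 <= Y x) -> \int[P]_x Y x <= 1 ->
  \int[Q]_(x in D) (Y x * (w x)%:E) <= 1.
Proof.
move=> mY Y0 PY; apply: le_trans PY.
rewrite QE//; last 2 first.
- by move=> x; rewrite mule_ge0// lee_fin expR_ge0.
- exact: emeasurable_funM.
rewrite (eq_integral Y); last first.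
  move=> x /set_mem /= Zx.
  by rewrite -muleA -EFinM /w expRN lnK ?posrE// mulVf ?mule1// gt_eqF.
exact: ge0_subset_integral.
Qed.

(** The negative part of [ln Z] is at most [1 / Z], and the quotient bound
    applies to the constant [1]. This keeps the relative entropy away from the
    undetermined form [+oo - +oo]. *)
Lemma integral_ln_density_neg_le1 : \int[Q]_(x in D) (fun x => (ln (Z x))%:E)^\- x <= 1.
Proof.
have P1 : \int[P]_x (cst 1 x) <= 1.
  by rewrite integral_cst// mul1e; have /= -> := probability_setT P.
apply: le_trans (integral_quotient_le (measurable_cst _) (fun=> lee01) P1).
apply: ge0_le_integral => //.
- by apply: measurable_funTS; apply: measurable_funeneg; exact/measurable_EFinP.
- by apply: measurable_funTS; exact: emeasurable_funM.
- move=> x /= Zx; rewrite funenegE mul1e -EFinN -EFin_max lee_fin.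
  rewrite ge_max expR_ge0 andbT.
  by have := expR_ge1Dx (- ln (Z x)); rewrite -/(w x); lra.
Qed.

(** Integrating [lne_split_le] at [x := X] and [l := ln Z] over the support of
    [Z], the quotient [X / Z] contributes at most [1], which cancels the constant
    [1] on the left. *)
Lemma integral_lne_le :
  \int[Q]_x lne (X x) <= \int[Q]_(x in D) (ln (Z x))%:E.
Proof.
have mlneX : measurable_fun setT (fun x => lne (X x)).
  by apply: measurableT_comp mX; exact: measurable_lne.
rewrite (integral_full_set mD QD)//.
set U := fun x => lne (X x); set L := fun x => (ln (Z x))%:E.
have mL : measurable_fun setT L by exact/measurable_EFinP.
have mU : measurable_fun setT U by [].
have mDpos (F : T -> \bar R) : measurable_fun setT F ->
    measurable_fun D F^\+.
  by move=> mF; apply: measurable_funTS; exact: measurable_funepos.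
have mDneg (F : T -> \bar R) : measurable_fun setT F ->
    measurable_fun D F^\-.
  by move=> mF; apply: measurable_funTS; exact: measurable_funeneg.
have mXw : measurable_fun D (fun x => X x * (w x)%:E).
  by apply: measurable_funTS; exact: emeasurable_funM.
have Xw0 x : D x -> 0 <= X x * (w x)%:E.
  by move=> _; rewrite mule_ge0// lee_fin expR_ge0.
have split_le : \int[Q]_(x in D) U^\+ x + \int[Q]_(x in D) L^\- x + 1 <=
    \int[Q]_(x in D) L^\+ x + 1 + \int[Q]_(x in D) U^\- x.
  apply: (@le_trans _ _
    (\int[Q]_(x in D) (U^\+ x + L^\- x + 1))).
    rewrite ge0_integralD//.
    - rewrite ge0_integralD//; [|exact: mDpos|exact: mDneg].
      rewrite leeD2l// -(integral_full_set mD QD)// integral_cst// mul1e.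
      by have /= -> := probability_setT Q.
    - by move=> x _; rewrite adde_ge0.
    - by apply: emeasurable_funD; [exact: mDpos|exact: mDneg].
  apply: (@le_trans _ _
    (\int[Q]_(x in D) (L^\+ x + X x * (w x)%:E + U^\- x))).
    apply: ge0_le_integral => //.
    - by move=> x _; rewrite !adde_ge0.
    - apply: emeasurable_funD => //.
      by apply: emeasurable_funD; [exact: mDpos|exact: mDneg].
    - apply: emeasurable_funD; last exact: mDneg.
      by apply: emeasurable_funD => //; exact: mDpos.
    - by move=> x Dx; rewrite !funeposE !funenegE; exact: lne_split_le.
  rewrite ge0_integralD//; last 3 first.
  - by move=> x Dx; rewrite adde_ge0// Xw0.
  - by apply: emeasurable_funD => //; exact: mDpos.
  - exact: mDneg.
  rewrite ge0_integralD//; last exact: mDpos.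
  by rewrite leeD2r// leeD2l//; exact: integral_quotient_le.
have ge0 (F : T -> \bar R) : (forall x, 0 <= F x) -> 0 <= \int[Q]_(x in D) F x.
  by move=> F0; apply: integral_ge0.
have Lneg : \int[Q]_(x in D) L^\- x \is a fin_num.
  rewrite ge0_fin_numE; last exact: ge0.
  exact: le_lt_trans integral_ln_density_neg_le1 (ltry _).
rewrite (integralE _ _ U) (integralE _ _ L).
have [->|Uoo] := eqVneq (\int[Q]_(x in D) U^\- x) +oo.
  by rewrite addeNy leNye.
have Uneg : \int[Q]_(x in D) U^\- x \is a fin_num.
  by rewrite ge0_fin_numE ?ltey//; exact: ge0.
rewrite leeBlDr// addeAC leeBrDr//.
by move: split_le; rewrite [X in _ <= X -> _]addeAC leeD2rE.
Qed.

End EntropyLowerBound.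

(** * Duality between growth and relative entropy *)

Section RelativeEntropy.
Context {R : realType} {T : ptopologicalType}.
Implicit Types (P Q : M1 R T) (PP QQ : set (M1 R T)).

(** The hard half of the variational formula: relative entropy is at most the
    supremum of the gap over bounded continuous functions. *)
Lemma rel_entropy_le P Q (v : \bar R) : completely_metrizable R T ->
  (forall f : T -> R, Cb f -> ((entropy_gap Q P f)%:E <= v)%E) ->
  (rel_entropy Q P <= v)%E.
Proof.
move=> /completely_metrizable_dist[d dd].
case: v => [r| |] gap_le; last 2 first.
- exact: leey.
- by have := gap_le _ (Cb_cst 0); rewrite leeNy_eq.
have gap_bounded := entropy_gap_bounded dd gap_le.
have QP : Q `<< P := entropy_gap_dominates gap_bounded.
rewrite /rel_entropy asboolT// ext_expectationE.
have [Z [mZ Z0 QD -> QE]] := density_exists QP.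
exact: (integral_ln_density_le mZ Z0 QD QE gap_bounded).
Qed.

Lemma growth_le_rel_entropy PP QQ P Q : PP P -> QQ Q ->
  (growth QQ (evariable PP) <= rel_entropy Q P)%E.
Proof.
move=> PPP QQQ; apply: ge_ereal_sup => _ [X [mX X0 XP] <-].
apply: (@le_trans _ _ (ext_expectation Q (fun x => lne (X x)))).
  by apply: ereal_inf_lbound; exists Q.
rewrite /rel_entropy; case: asboolP => QP; last exact: leey.
rewrite !ext_expectationE; have [Z [mZ Z0 QD -> QE]] := density_exists QP.
exact: (integral_lne_le mZ QD QE mX X0 (XP _ PPP)).
Qed.

Lemma growthS QQ (E F : set (borel T -> \bar R)) : E `<=` F ->
  (growth QQ E <= growth QQ F)%E.
Proof. by move=> EF; apply: ereal_sup_le; exact: image_subset. Qed.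

(** Dividing [expR f] by [s], the supremum of its expectations over [PP], yields
    an e-variable; its expected logarithm under [Q] is [int f dQ - ln s], which is
    at least the gap because [ln s <= s - 1]. *)
Lemma growth_bc_ge PP QQ (f : T -> R) (r : R) : PP !=set0 -> Cb f ->
  (forall P Q, PP P -> QQ Q -> r <= entropy_gap Q P f) ->
  (r%:E <= growth QQ (evariable_bc PP))%E.
Proof.
move=> [P0 PP0] Cf gap_ge; have [cf [M fM]] := (CbP f).1 Cf.
pose I P := \int[P]_x expR ((f : borel T -> R) x).
have Cexp := Cb_expR Cf.
have bounds x : expR (- M) <= expR (f x) <= expR M.
  by have := fM x; rewrite !ler_expR ler_norml.
have iexp P : P.-integrable setT
    (EFin \o (fun x : borel T => expR ((f : borel T -> R) x))).
  apply: (@bounded_integrable _ _ _ P setT _ (expR M)) => //.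
    exact: Cb_measurable Cexp.
  by move=> x; rewrite ger0_norm ?expR_ge0//; have /andP[] := bounds x.
have icst P (c : R) : P.-integrable setT (EFin \o cst c).
  exact: finite_measure_integrable_cst.
have intcst P (c : R) : \int[P]_x c = c.
  by rewrite Rintegral_cst//; have /= -> := probability_setT P; rewrite mulr1.
have I_le P : I P <= expR M.
  rewrite -(intcst P (expR M)).
  apply: le_Rintegral; [by []|exact: iexp|exact: icst|].
  by move=> x _; have /andP[] := bounds x.
have I_ge P : expR (- M) <= I P.
  rewrite -(intcst P (expR (- M))).
  apply: le_Rintegral; [by []|exact: icst|exact: iexp|].
  by move=> x _; have /andP[] := bounds x.
pose S := [set I P | P in PP]; pose s := sup S.
have S0 : S !=set0 by exists (I P0), P0.
have supS : has_sup S by split=> //; exists (expR M) => _ [P _ <-].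
have I_s P : PP P -> I P <= s.
  by move=> PPP; apply: sup_ubound; [case: supS|exists P].
have s0 : 0 < s.
  by apply: lt_le_trans (I_s _ PP0); apply: lt_le_trans (I_ge _); exact: expR_gt0.
pose g x := f x - ln s.
have Cg : Cb (fun x => expR (g x)).
  apply: Cb_expR; have := Cb_lin 1 (- ln s) Cf (Cb_cst 1); congr Cb.
  by apply/funext => x; rewrite /g mul1r mulr1.
pose X : borel T -> \bar R := fun x => (expR (g x))%:E.
have EX : evariable_bc PP X.
  split; last by exists (fun x => expR (g x)).
  split; last first.
    exists (expR (- M - ln s)); first exact: expR_gt0.
    move=> x; rewrite lee_fin ler_expR lerD2r.
    by have := fM x; rewrite ler_norml => /andP[].
  split; last first.
    exists (expR (M - ln s)) => x; rewrite lee_fin ler_expR lerD2r.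
    by have := fM x; rewrite ler_norml => /andP[].
  split.
  - by apply/measurable_EFinP; exact: Cb_measurable Cg.
  - by move=> x; rewrite lee_fin expR_ge0.
  - move=> P PPP; rewrite /X.
    under eq_integral do rewrite /g addrC expRD expRN lnK ?posrE// EFinM.
    rewrite (integralZl measurableT (iexp P)).
    have -> : (\int[P]_x (expR (f x))%:E = (I P)%:E)%E.
      by rewrite /I /Rintegral fineK//; exact: integrable_fin_num (iexp P).
    by rewrite -EFinM lee_fin mulrC ler_pdivrMr// mul1r; exact: I_s.
apply: (@le_trans _ _
  (ereal_inf [set ext_expectation Q (fun x => lne (X x)) | Q in QQ])).
  apply: le_ereal_inf_tmp => _ [Q QQQ <-]; rewrite ext_expectationE.
  have if_ : Q.-integrable setT (EFin \o (f : borel T -> R)).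
    apply: (@bounded_integrable _ _ _ Q setT _ M) => //.
    exact: Cb_measurable Cf.
  have -> : (\int[Q]_x lne (X x) =
      (\int[Q]_x (f : borel T -> R) x - ln s)%:E)%E.
    under eq_integral do rewrite /X lne_EFin ?expR_gt0// expRK /g EFinB.
    rewrite (integralB measurableT if_ (icst Q (ln s))).
    have -> : (\int[Q]_x (EFin \o cst (ln s)) x = (ln s)%:E)%E.
      rewrite (_ : _ \o _ = cst (ln s)%:E)// integral_cst//.
      by have /= -> := probability_setT Q; rewrite mule1.
    rewrite EFinB /Rintegral fineK//; exact: integrable_fin_num if_.
  rewrite lee_fin.
  have s_le : s <= \int[Q]_x (f : borel T -> R) x + 1 - r.
    apply: ge_sup => // _ [P PPP <-].
    by have := gap_ge _ _ PPP QQQ; rewrite /entropy_gap /I; lra.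
  have := @le_ln1Dx R (s - 1); rewrite (addrC 1) subrK; lra.
by apply: ereal_sup_ubound; exists X.
Qed.

Local Notation weakM1 := (initial_topology (@Cb_integral R T)).

Lemma Cb_integral_continuous (f : T -> R) : Cb f ->
  continuous (fun P : weakM1 => \int[P]_x (f : borel T -> R) x).
Proof.
move=> Cf P.
have /(_ P) c1 := @initial_continuous _ _ (@Cb_integral R T).
have c2 := @proj_continuous {classic {f : T -> R | Cb f}} (fun=> R) (exist _ f Cf).
exact: (@continuous_comp _ _ _ (@Cb_integral R T : weakM1 -> _)
  (fun u : prod_topology (fun _ : {f : T -> R | Cb f} => R) => u (exist _ f Cf))
  P c1 (c2 _)).
Qed.

Lemma entropy_gap_continuous (f : T -> R) : Cb f ->
  continuous (fun x : weakM1 * weakM1 => entropy_gap x.2 x.1 f).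
Proof.
move=> Cf x; apply: cvgD; last exact: cvg_cst.
apply: cvgB.
- apply: (@continuous_comp _ _ _ snd (fun P : weakM1 => \int[P]_x (f : borel T -> R) x)).
    exact: cvg_snd.
  exact: Cb_integral_continuous.
- apply: (@continuous_comp _ _ _ fst
    (fun P : weakM1 => \int[P]_x (fun x : borel T => expR (f x)) x)).
    exact: cvg_fst.
  exact: (Cb_integral_continuous (Cb_expR Cf)).
Qed.

(** Strong duality with attainment at once: if the relative entropy exceeded the
    growth at every pair, so would the gap for some test function depending on
    the pair, and by the minimax theorem for a single test function; normalizing
    it would produce an e-variable that beats the growth. *)
Lemma rel_entropy_le_growth PP QQ : completely_metrizable R T ->
  PP !=set0 -> QQ !=set0 -> convex_family PP -> convex_family QQ ->
  weakly_compact PP -> weakly_compact QQ ->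
  exists P Q, [/\ PP P, QQ Q & (rel_entropy Q P <= growth QQ (evariable_bc PP))%E].
Proof.
move=> metT [P0 PP0] [Q0 QQ0] cvxP cvxQ cP cQ; apply: contrapT => none.
set v := growth QQ _ in none.
have [] := @minimax_convexlike R {f : T -> R | Cb f} _
  (fun i (x : weakM1 * weakM1) => entropy_gap x.2 x.1 (sval i)) (PP `*` QQ) v
  (compact_setX cP cQ).
- by exists (P0, Q0).
- by move=> [f Cf]; exact: entropy_gap_continuous.
- move=> [f Cf] [g Cg] t t01.
  have [_ [M fM]] := (CbP f).1 Cf; have [_ [N gN]] := (CbP g).1 Cg.
  exists (exist _ _ (Cb_lin (1 - t) t Cf Cg)) => -[P Q] /=.
  apply: (@entropy_gap_concave _ _ _ P Q f g (Num.max M N)) => //.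
  + exact: Cb_measurable.
  + exact: Cb_measurable.
  + by move=> x; rewrite le_max fM.
  + by move=> x; rewrite le_max gN orbT.
- move=> [P1 Q1] [P2 Q2] t [/= PP1 QQ1] [/= PP2 QQ2] t01.
  have [P PPP PE] := cvxP _ _ _ PP1 PP2 t01.
  have [Q QQQ QE] := cvxQ _ _ _ QQ1 QQ2 t01.
  exists (P, Q) => // -[f Cf] /=.
  have [_ [M fM]] := (CbP f).1 Cf.
  have mf : measurable_fun setT (f : borel T -> R) := Cb_measurable Cf.
  rewrite /entropy_gap (Rintegral_mixture t01 QE mf fM).
  rewrite (@Rintegral_mixture _ _ _ P P1 P2 t (expR M) _ t01 PE); last 2 first.
  + exact: measurableT_comp.
  + by move=> x; exact: norm_expR_le.
  by rewrite le_eqVlt; apply/orP; left; apply/eqP; ring.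
- move=> [P Q] [/= PPP QQQ]; apply: contrapT => nogap; apply: none.
  exists P, Q; split => //; apply: rel_entropy_le => // f Cf.
  by rewrite leNgt; apply/negP => vf; apply: nogap; exists (exist _ f Cf).
move=> [f Cf] [r [vr gap_ge]].
have := growth_bc_ge (PP := PP) (QQ := QQ) (ex_intro _ P0 PP0) Cf
  (fun P Q PPP QQQ => gap_ge (P, Q) (conj PPP QQQ)).
by rewrite leNgt vr.
Qed.

End RelativeEntropy.

Local Open Scope ereal_scope.

Theorem theorem4p19 (R : realType) (Omega : ptopologicalType)
    (PP QQ : set (M1 R Omega)) :
  polish R Omega ->
  PP !=set0 -> QQ !=set0 ->
  convex_family PP -> convex_family QQ ->
  weakly_compact PP -> weakly_compact QQ ->
  [/\ growth QQ (evariable PP) = growth QQ (evariable_b PP),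
      growth QQ (evariable_b PP) = growth QQ (evariable_bb PP),
      growth QQ (evariable_bb PP) = growth QQ (evariable_bc PP) &
      exists h : M1 R Omega -> \bar R,
        (forall Q, QQ Q -> is_minimum [set rel_entropy Q P | P in PP] (h Q)) /\
        is_minimum [set h Q | Q in QQ] (growth QQ (evariable_bc PP))].
Proof.
move=> [_ metT] PP0 QQ0 cvxP cvxQ cP cQ.
have [P [Q [PPP QQQ gap]]] := rel_entropy_le_growth metT PP0 QQ0 cvxP cvxQ cP cQ.
have bc_bb : growth QQ (evariable_bc PP) <= growth QQ (evariable_bb PP).
  by apply: growthS => X [].
have bb_b : growth QQ (evariable_bb PP) <= growth QQ (evariable_b PP).
  by apply: growthS => X [].
have b_all : growth QQ (evariable_b PP) <= growth QQ (evariable PP).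
  by apply: growthS => X [].
have bc_all : growth QQ (evariable_bc PP) <= growth QQ (evariable PP).
  exact: le_trans bc_bb (le_trans bb_b b_all).
have all_bc : growth QQ (evariable PP) <= growth QQ (evariable_bc PP).
  by apply: le_trans gap; exact: growth_le_rel_entropy.
split.
- by apply/eqP; rewrite eq_le b_all (le_trans all_bc)// (le_trans bc_bb).
- apply/eqP; rewrite eq_le bb_b andbT.
  exact: le_trans b_all (le_trans all_bc bc_bb).
- apply/eqP; rewrite eq_le bc_bb andbT.
  exact: le_trans bb_b (le_trans b_all all_bc).
exists (fun Q' => ereal_inf [set rel_entropy Q' P' | P' in PP]).
have inf_min Q' : QQ Q' -> is_minimum [set rel_entropy Q' P' | P' in PP]
    (ereal_inf [set rel_entropy Q' P' | P' in PP]).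
  move=> QQ'; split; last by move=> y; exact: ereal_inf_lbound.
  (* strong duality for the one-element family [Q'] provides the minimizer in
     [PP], and weak duality for it the minimality *)
  have [P1 [Q1 [PP1 Q1E min1]]] :
      exists P1 Q1, [/\ PP P1, Q1 = Q' &
        rel_entropy Q1 P1 <= growth [set Q'] (evariable_bc PP)].
    apply: rel_entropy_le_growth => //.
    - by exists Q'.
    - move=> _ _ t -> -> /andP[t0 t1]; exists Q' => // A mA.
      by rewrite -ge0_muleDl ?lee_fin ?subr_ge0// -EFinD subrK mul1e.
    - exact: (@compact_set1 (initial_topology (@Cb_integral R Omega))).
  exists P1 => //; apply/eqP; rewrite eq_le; apply/andP; split; last first.
    by apply: ereal_inf_lbound; exists P1.
  apply: le_ereal_inf_tmp => _ [P2 PP2 <-].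
  move: min1; rewrite Q1E => min1; apply: (le_trans min1).
  apply: (@le_trans _ _ (growth [set Q'] (evariable PP))).
    by apply: growthS => X [[[]]].
  exact: growth_le_rel_entropy.
split => //; split.
  exists Q => //; apply/eqP; rewrite eq_le; apply/andP; split.
    by apply: le_trans gap; apply: ereal_inf_lbound; exists P.
  apply: le_ereal_inf_tmp => _ [P2 PP2 <-].
  exact: le_trans bc_all (growth_le_rel_entropy PP2 QQQ).
move=> _ [Q' QQ' <-]; apply: le_ereal_inf_tmp => _ [P2 PP2 <-].
exact: le_trans bc_all (growth_le_rel_entropy PP2 QQ').
Qed.
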